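(* Let $(G,\omega)$ be a connected decorated planar graph of nilpotency degree zero. If $\Gamma^{\mathrm{inv}}_{(G,\omega)}$ is connected, then $\mathcal{L}(G,\omega)$ is a distributive lattice, and the minimum $f_-$ of $\mathcal{L}(G,\omega)$ induces an isomorphism of distributive lattices $\mathrm{BMS}^+(G,\omega;f_-)\to\mathcal{L}(G,\omega)$ given by the forgetful map $$\pi\colon \mathrm{BMS}^+(G,\omega;f_-)\to\mathcal{L}(G,\omega),\qquad (f_+,f_-,d)\mapsto f_+ .$$
   Context: **Planar graphs.** $G=(V_G,E_G)$ is a finite connected undirected multigraph (multiple edges allowed) without loops, with every vertex of degree $\ge 2$, embedded in the oriented sphere $S^2$. An angle at a vertex $v$ is a pair of half-edges at $v$ that are consecutive in the clockwise cyclic order around $v$; it is oriented clockwise, from its source edge $s(a)$ to its target edge $t(a)$ (the next edge clockwise). $A_G$ is the set of angles. Every edge is the source of exactly two angles and the target of exactly two angles. The directed medial graph $\mathcal{Q}G$ has vertex set $E_G$ and one arrow $s(a)\to t(a)$ for each $a\in A_G$; $|\mathcal{Q}G|$ is its geometric realization, a 1-dimensional CW complex. **Weights.** A weight is a class $\omega\in H^1(|\mathcal{Q}G|;\mathbb{Z})$, and $(G,\omega)$ is called a decorated planar graph. An angular function is a map $g\colon A_G\to\mathbb{Z}_{\ge0}$; it is $\omega$-compatible if, viewed as a cellular 1-cochain of $|\mathcal{Q}G|$, it represents $\omega$. $\mathcal{L}(G,\omega)$ is the set of $\omega$-compatible angular functions. **Moves.** For $\epsilon\colon E_G\to\mathbb{Z}$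 let $(\delta\epsilon)(a)=\epsilon(t(a))-\epsilon(s(a))$; $\chi_e$ is the characteristic function of $e\in E_G$. $g\in\mathcal{L}(G,\omega)$ is $e$-movable if $g+\delta\chi_e\ge0$ on $A_G$; then $\mathrm{mov}_e(g)=g+\delta\chi_e\in\mathcal{L}(G,\omega)$. $\mathcal{L}(G,\omega)$ is a directed graph: there is an edge $g\to\mathrm{mov}_e(g)$ for each $e$ such that $g$ is $e$-movable. **Nilpotency degree and invisible cycles.** An angular cycle is a cellular 1-cycle of $|\mathcal{Q}G|$ with non-negative coefficients in the basis of arrows; $\lambda_\omega(c)\in\mathbb{Z}$ is the value of $\omega$ on the class of $c$ (so $\lambda_\omega(c)=\sum_a c_a g(a)$ for any $\omega$-compatible $g$). $(G,\omega)$ has nilpotency degree zero if $\min\{\lambda_\omega(c): c\text{ a non-zero angular cycle}\}=0$. An invisible angular cycle is a non-zero angular cycle with $\lambda_\omega(c)=0$; it is connected if the arrows with non-zero coefficient form a connected subgraph of $\mathcal{Q}G$. The graph $\Gamma^{\mathrm{inv}}_{(G,\omega)}$ has as vertices the connected invisible angular cycles, two of them being joined by an edge precisely when they share a vertex of $\mathcal{Q}G$ (i.e. a common edge of $G$). **BMS states.** A dimension vector is a map $d\colon E_G\to\mathbb{Z}_{\ge0}$. A weak BMS state is a triple $(f_+,f_-,d)$ with $f_\pm\in\mathcal{L}(G,\omega)$, $d$ a dimension vector and $f_+=f_-+\delta d$. It is a BMS state if $d(e)=0$ for every edge $e$ belonging to a connected invisible angular cycle. $\mathrm{BMS}(G,\omega)$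 is the directed graph whose vertices are the BMS states, with an edge from $(f_+,f_-,d)$ to $(f_++\delta\chi_e,f_-,d+\chi_e)$ for each $e\in E_G$ such that $f_+$ is $e$-movable. For $g\in\mathcal{L}(G,\omega)$, $\mathrm{BMS}^+(G,\omega;g)$ is the full subgraph on the BMS states with $f_-=g$. **Order.** Both $\mathcal{L}(G,\omega)$ and $\mathrm{BMS}^+(G,\omega;g)$ carry the relation ''$x\le y$ iff there is a directed path from $x$ to $y$''; lattice statements refer to this relation. *)

(* Defs.v *)
From HB Require Import structures.
From Stdlib Require Import Relations.Relation_Operators.
From mathcomp Require Import all_boot all_order all_algebra perm.
From mathcomp Require Import boolp.

Set Implicit Arguments.
Unset Strict Implicit.
Unset Printing Implicit Defensive.

Import GRing.Theory Num.Theory.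
Local Open Scope ring_scope.
Local Open Scope quotient_scope.

(* An embedded graph is encoded by its rotation system: [rot h] is the next
   half-edge clockwise around the vertex of [h], and [opp h] is the other half
   of the edge of [h].  The faces are the orbits of [h |-> rot (opp h)] (the
   product of permutations applies its left factor first), and for a connected
   graph the surface so described is the sphere iff Euler's formula holds; the
   formula also forces the graph to be non-empty. *)
Record planarGraph := PlanarGraph {
  vertex : finType;
  edge : finType;
  half_edge : finType;
  vtx : half_edge -> vertex;
  edg : half_edge -> edge;
  opp : {perm half_edge};
  rot : {perm half_edge};
  card_edge_halves : forall e : edge, #|[set h | edg h == e]| = 2%N;
  edg_opp : forall h, edg (opp h) = edg h;
  opp_neq : forall h, opp h != h;
  rot_vtx : forall h h', (h' \in porbit rot h) = (vtx h' == vtx h);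
  loopless : forall h, vtx (opp h) != vtx h;
  degree_ge2 : forall v : vertex, (2 <= #|[set h | vtx h == v]|)%N;
  connected_graph : forall u v : vertex,
    connect (fun x y => [exists h, (vtx h == x) && (vtx (opp h) == y)]) u v;
  euler : (#|vertex| + #|porbits (opp * rot)%g| = #|edge| + 2)%N
}.

(* An angle (h, rot h) is determined by its source half-edge h. *)
Definition angle (G : planarGraph) : finType := half_edge G.
Definition src (G : planarGraph) (a : angle G) : edge G := edg a.
Definition tgt (G : planarGraph) (a : angle G) : edge G := edg (rot G a).

(* Cellular cochains (and, in the dual bases, chains) of |QG|. *)
Definition C0 (G : planarGraph) := {ffun edge G -> int}.
Definition C1 (G : planarGraph) := {ffun angle G -> int}.

Definition delta (G : planarGraph) (eps : C0 G) : C1 G :=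
  [ffun a => eps (tgt a) - eps (src a)].

Definition boundary (G : planarGraph) (c : C1 G) : C0 G :=
  [ffun e => \sum_(a | tgt a == e) c a - \sum_(a | src a == e) c a].

Definition chi (G : planarGraph) (e : edge G) : C0 G := [ffun x => (x == e)%:R].

Definition coboundary (G : planarGraph) : {pred C1 G} :=
  fun w => `[< exists eps : C0 G, w = delta eps >].

Lemma coboundary_zmod_closed (G : planarGraph) :
  zmod_closed (@coboundary G).
Proof.
split=> [|_ _ /asboolP[e1 ->] /asboolP[e2 ->]]; apply/asboolP.
  by exists 0; apply/ffunP=> a; rewrite !ffunE subrr.
exists (e1 - e2); apply/ffunP=> a; rewrite !ffunE.
by rewrite !opprD addrACA.
Qed.

HB.instance Definition _ (G : planarGraph) :=
  GRing.isZmodClosed.Build (C1 G) (@coboundary G) (@coboundary_zmod_closed G).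

(* H^1(|QG|; Z): as |QG| is 1-dimensional, every 1-cochain is a cocycle. *)
Definition weight (G : planarGraph) := Quotient.quot (@coboundary G).

Definition cohom_class (G : planarGraph) (w : C1 G) : weight G :=
  \pi_(weight G) w.

Section Decorated.

Variables (G : planarGraph) (omega : weight G).

Definition compatible (g : C1 G) : bool :=
  [forall a, 0 <= g a] && (cohom_class g == omega).

Definition L : Type := {g : C1 G | compatible g}.

Definition movable (g : L) (e : edge G) : Prop :=
  forall a, 0 <= (val g + delta (chi e)) a.

Definition L_step (g g' : L) : Prop :=
  exists2 e, movable g e & val g' = val g + delta (chi e).

Definition L_le : L -> L -> Prop := clos_refl_trans L L_step.

Definition angular_cycle (c : C1 G) : Prop :=
  boundary c = 0 /\ forall a, 0 <= c a.

(* By [lambdaE] below, the value does not depend on the representative. *)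
Definition lambda (c : C1 G) : int := \sum_a c a * (repr omega) a.

Definition nilpotency_degree_zero : Prop :=
  (exists c, [/\ angular_cycle c, c <> 0 & lambda c = 0]) /\
  (forall c, angular_cycle c -> c <> 0 -> 0 <= lambda c).

Definition invisible_cycle (c : C1 G) : Prop :=
  [/\ angular_cycle c, c <> 0 & lambda c = 0].

Definition support_vertices (c : C1 G) : {set edge G} :=
  [set e | [exists a, (c a != 0) && ((src a == e) || (tgt a == e))]].

Definition support_adj (c : C1 G) : rel (edge G) := fun e e' =>
  [exists a, (c a != 0) &&
     ((src a == e) && (tgt a == e') || (src a == e') && (tgt a == e))].

Definition connected_support (c : C1 G) : Prop :=
  {in support_vertices c &, forall e e', connect (support_adj c) e e'}.

Definition connected_invisible (c : C1 G) : Prop :=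
  invisible_cycle c /\ connected_support c.

Definition Ginv : Type := {c : C1 G | `[< connected_invisible c >]}.

Definition Ginv_adj (c c' : Ginv) : Prop :=
  exists e, (e \in support_vertices (val c)) /\
            (e \in support_vertices (val c')).

Definition Ginv_connected : Prop :=
  forall c c' : Ginv, clos_refl_sym_trans Ginv Ginv_adj c c'.

Definition weak_BMS (fp fm : L) (d : C0 G) : Prop :=
  (forall e, 0 <= d e) /\ val fp = val fm + delta d.

Definition is_BMS (x : L * L * C0 G) : Prop :=
  let: (fp, fm, d) := x in
  weak_BMS fp fm d /\
  forall e c, connected_invisible c -> e \in support_vertices c -> d e = 0.

Definition BMS : Type := {x : L * L * C0 G | `[< is_BMS x >]}.

Definition fplus (x : BMS) : L := (val x).1.1.
Definition fminus (x : BMS) : L := (val x).1.2.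
Definition dimv (x : BMS) : C0 G := (val x).2.

Definition BMS_step (x y : BMS) : Prop :=
  exists e, [/\ movable (fplus x) e,
    val (fplus y) = val (fplus x) + delta (chi e),
    fminus y = fminus x & dimv y = dimv x + chi e].

Definition BMSplus (g : L) : Type := {x : BMS | fminus x == g}.

Definition BMSplus_le (g : L) : BMSplus g -> BMSplus g -> Prop :=
  clos_refl_trans (BMSplus g) (fun x y => BMS_step (val x) (val y)).

Definition forget (g : L) (x : BMSplus g) : L := fplus (val x).

Lemma cohom_classE (g : C1 G) :
  cohom_class g = omega -> exists eps, g = repr omega + delta eps.
Proof.
move=> gE; have : (g - repr omega) \in @coboundary G.
  by rewrite Quotient.idealrBE reprK; apply/eqP.
by move=> /asboolP[eps geps]; exists eps; rewrite -geps addrC subrK.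
Qed.

Lemma pairing_delta (c : C1 G) (eps : C0 G) :
  \sum_a c a * delta eps a = \sum_e boundary c e * eps e.
Proof.
under eq_bigr => a _ do rewrite ffunE mulrBr.
under [RHS]eq_bigr => e _ do rewrite ffunE mulrBl !mulr_suml.
rewrite !sumrB; congr (_ - _).
  rewrite (partition_big (@tgt G) predT) //=; apply: eq_bigr => e _.
  by apply: eq_bigr => a /eqP ->.
rewrite (partition_big (@src G) predT) //=; apply: eq_bigr => e _.
by apply: eq_bigr => a /eqP ->.
Qed.

Lemma lambdaE (c g : C1 G) : boundary c = 0 -> cohom_class g = omega ->
  lambda c = \sum_a c a * g a.
Proof.
move=> c0 /cohom_classE[eps ->].
under [RHS]eq_bigr => a _ do rewrite [X in _ * X]ffunE mulrDr.
rewrite big_split /= pairing_delta c0 [X in _ + X]big1 ?addr0 //.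
by move=> e _; rewrite ffunE mul0r.
Qed.

End Decorated.

(* A distributive lattice structure on T whose order is the relation le. *)
Record distrLatticeOn (T : Type) (le : T -> T -> Prop) := DistrLatticeOn {
  dl_display : Order.disp_t;
  dl_class : Order.DistrLattice dl_display T;
  dl_type := Order.DistrLattice.Pack dl_class;
  dl_leP : forall x y : T, le x y <-> ((x : dl_type) <= (y : dl_type))%O
}.

Definition dl_meet (T : Type) (le : T -> T -> Prop) (D : distrLatticeOn le) :
  T -> T -> T := @Order.meet (dl_display D) (dl_type D).
Definition dl_join (T : Type) (le : T -> T -> Prop) (D : distrLatticeOn le) :
  T -> T -> T := @Order.join (dl_display D) (dl_type D).

Definition distr_lattice_iso (T1 T2 : Type) (le1 : T1 -> T1 -> Prop)
    (le2 : T2 -> T2 -> Prop) (D1 : distrLatticeOn le1) (D2 : distrLatticeOn le2)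
    (f : T1 -> T2) : Prop :=
  [/\ bijective f,
      {morph f : x y / dl_meet D1 x y >-> dl_meet D2 x y} &
      {morph f : x y / dl_join D1 x y >-> dl_join D2 x y}].

(* Main.v *)
(* Fix an edge e0 on an invisible cycle.  Compatible functions are the g + delta eps
   >= 0, and eps is unique once normalised by eps e0 = 0, since the medial graph is
   connected; these difference constraints are stable under pointwise min and max.
   Every compatible function vanishes on the invisible cycles, so by connectedness
   of Ginv the normalised eps vanishes on all of them, and moves never touch e0;
   hence a directed path increases eps.  Conversely, if eps >= 0 leads from x to y
   and no edge with eps > 0 is movable, zero arrows of x keep one inside
   {eps > 0}, which therefore contains an invisible cycle: a contradiction.  So the
   order is the pointwise order of the potentials.  In a BMS state over the minimum,
   d is the normalised potential from f_- to f_+, so f_+ determines the state. *)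
Require Import Defs.
From Stdlib Require Import Relations.Relation_Operators.
From HB Require Import structures.
From mathcomp Require Import all_boot all_order all_algebra.
From mathcomp Require Import perm boolp zify ring lra.

Set Implicit Arguments.
Unset Strict Implicit.
Unset Printing Implicit Defensive.

Import Order.TTheory GRing.Theory Num.Theory.
Local Open Scope ring_scope.

(** * Minimisers, propagation along paths, and lattices embedded in integer vectors *)

Lemma exists_minimizer (T : Type) (f : T -> nat) (x0 : T) :
  exists x, forall y, (f x <= f y)%N.
Proof.
have ex : exists n, `[< exists x, f x = n >] by exists (f x0); apply/asboolP; exists x0.
case: (ex_minnP ex) => _ /asboolP[x <-] xmin; exists x => y.
by apply: xmin; apply/asboolP; exists y.
Qed.

Lemma connect_propagate (T : finType) (r : rel T) (P : T -> Prop) (x y : T) :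
  (forall u v, r u v -> P u -> P v) -> connect r x y -> P x -> P y.
Proof.
move=> rP /connectP[p]; elim: p x => [|z p IH] x /=; first by move=> _ ->.
by case/andP=> xz zp ylast Px; apply: (IH z) => //; apply: rP Px.
Qed.

(** Through [phi], [meet] and [join] become the coordinatewise minimum and maximum of integer
    vectors, and injectivity pulls the lattice identities back to [T]. *)
Lemma distrLatticeOn_pointwise (T : Type) (I : finType)
    (le : T -> T -> Prop) (phi : T -> {ffun I -> int}) (meet join : T -> T -> T) :
  injective phi ->
  (forall x y, le x y <-> forall i, phi x i <= phi y i) ->
  (forall x y i, phi (meet x y) i = Num.min (phi x i) (phi y i)) ->
  (forall x y i, phi (join x y) i = Num.max (phi x i) (phi y i)) ->
  exists D : distrLatticeOn le, dl_meet D = meet /\ dl_join D = join.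
Proof.
move=> phi_inj leP meetE joinE.
have eqP_phi x y : (forall i, phi x i = phi y i) -> x = y.
  by move=> xy; apply/phi_inj/ffunP.
pose cT : choiceType := HB.pack T (gen_eqMixin T) (gen_choiceMixin T).
(* The structure needs a Boolean order; [lebP] identifies this one with [le]. *)
pose leb (x y : cT) := (meet x y : cT) == x.
have lebP x y : le x y <-> leb x y.
  rewrite leP; split=> [xy|/eqP xy i].
    by apply/eqP/eqP_phi => i; rewrite meetE; apply/min_idPl.
  by rewrite -xy meetE ge_min lexx orbT.
pose ltb (x y : cT) := (y != x) && leb x y.
have meetC : commutative meet by move=> x y; apply: eqP_phi => i; rewrite !meetE minC.
have joinC : commutative join by move=> x y; apply: eqP_phi => i; rewrite !joinE maxC.
have meetA : associative meet by move=> x y z; apply: eqP_phi => i; rewrite !meetE minA.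
have joinA : associative join by move=> x y z; apply: eqP_phi => i; rewrite !joinE maxA.
have joinKI y x : meet x (join x y) = x.
  by apply: eqP_phi => i; rewrite meetE joinE; apply/min_idPl; rewrite le_max lexx.
have meetKU y x : join x (meet x y) = x.
  by apply: eqP_phi => i; rewrite joinE meetE; apply/max_idPl; rewrite ge_min lexx.
have meetUl : left_distributive meet join.
  by move=> x y z; apply: eqP_phi => i; rewrite !(meetE, joinE) min_maxl.
have meetxx : idempotent_op meet by move=> x; apply: eqP_phi => i; rewrite meetE minxx.
pose disp := Order.Disp tt tt.
pose P : distrLatticeType disp := HB.pack cT
  (Order.isMeetJoinDistrLattice.Build disp cT
    (fun x y => erefl (leb x y)) (fun x y => erefl (ltb x y))
    meetC joinC meetA joinA joinKI meetKU meetUl meetxx).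
by exists (@DistrLatticeOn T le _ (Order.DistrLattice.class P) lebP).
Qed.

(** * Chains, coboundaries and connectivity of the medial graph *)

Section MedialGraph.

Variable G : planarGraph.
Implicit Types (a b : angle G) (e : edge G) (c g w : C1 G) (eps : C0 G).

Lemma deltaD eps1 eps2 : delta (eps1 + eps2) = delta eps1 + delta eps2.
Proof. by apply/ffunP=> a; rewrite !ffunE opprD addrACA. Qed.

Lemma boundaryD c1 c2 : boundary (c1 + c2) = boundary c1 + boundary c2.
Proof.
apply/ffunP=> e; rewrite !ffunE addrACA -opprD -!big_split /=.
by congr (_ - _); apply: eq_bigr => a _; rewrite ffunE.
Qed.

Definition arrow a : C1 G := [ffun b => (b == a)%:R].

Lemma boundary_arrow a : boundary (arrow a) = chi (tgt a) - chi (src a).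
Proof.
apply/ffunP=> e; rewrite !ffunE.
have sumE (f : angle G -> edge G) :
    \sum_(b | f b == e) arrow a b = (e == f a)%:R :> int.
  rewrite eq_sym; case: (eqVneq (f a) e) => [fa|fa] /=.
    rewrite (bigD1 a) ?fa //= ffunE eqxx big1 ?addr0 // => b /andP[_ ba].
    by rewrite ffunE (negPf ba).
  rewrite big1 // => b /eqP fb; rewrite ffunE; case: (eqVneq b a) => // ba.
  by rewrite -fb ba eqxx in fa.
by rewrite !sumE.
Qed.

Lemma sum_arrow a g : \sum_b arrow a b * g b = g a.
Proof.
rewrite (bigD1 a) //= ffunE eqxx mul1r big1 ?addr0 // => b ba.
by rewrite ffunE (negPf ba) mul0r.
Qed.

(** Otherwise [rot a] would be [a] or [opp a]: the first gives a vertex of degree one, the second a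
    loop. *)
Lemma src_neq_tgt a : src a != tgt a.
Proof.
apply/negP=> /eqP st.
have halves : [set h | edg h == edg a] = [set a; Defs.opp G a].
  apply/esym/eqP; rewrite eqEcard cards2 eq_sym opp_neq card_edge_halves andbT.
  by apply/subsetP=> h; rewrite !inE => /orP[]/eqP->; rewrite ?edg_opp.
have : Defs.rot G a \in [set a; Defs.opp G a] by rewrite -halves inE -[edg a]/(src a) st.
have rot_a : vtx (Defs.rot G a) = vtx a.
  by apply/eqP; rewrite -rot_vtx; have := mem_porbit (Defs.rot G) 1 a; rewrite expg1.
rewrite !inE => /orP[] /eqP rota; last first.
  by move: (loopless a); rewrite -rota rot_a eqxx.
have := degree_ge2 (vtx a); rewrite leqNgt => /negP; apply.
rewrite (@eq_card1 _ a) // => h; rewrite inE -rot_vtx inE.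
apply/porbitP/eqP=> [[i ->]|->]; last by exists 0; rewrite expg0 perm1.
by elim: i => [|i IH]; rewrite ?expg0 ?perm1 // expgSr permM IH.
Qed.

Definition medial_rel : rel (edge G) :=
  fun e e' => [exists a, (src a == e) && (tgt a == e')].

(** Turning around a vertex follows arrows, and passing to the opposite half-edge stays on the same
    edge, so a walk in the graph yields a directed path of the medial graph. *)
Lemma medial_connected e e' : connect medial_rel e e'.
Proof.
have half x : exists h : half_edge G, edg h = x.
  have : [set h | edg h == x] != set0 by rewrite -card_gt0 card_edge_halves.
  by case/set0Pn=> h; rewrite inE => /eqP; exists h.
have around h h' : vtx h' = vtx h -> connect medial_rel (edg h) (edg h').
  move/eqP; rewrite -rot_vtx => /porbitP[i ->]; elim: i => [|i IH].
    by rewrite expg0 perm1 connect0.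
  apply: connect_trans IH _; apply: connect1; apply/existsP.
  by exists ((Defs.rot G ^+ i)%g h); rewrite /src /tgt expgSr permM !eqxx.
have [[h <-] [h' <-]] := (half e, half e').
have := connected_graph (vtx h) (vtx h').
suff step u v : [exists k, (vtx k == u) && (vtx (Defs.opp G k) == v)] ->
    (forall k, vtx k = u -> connect medial_rel (edg h) (edg k)) ->
    forall k, vtx k = v -> connect medial_rel (edg h) (edg k).
  by move/(connect_propagate step); apply=> // k /around.
case/existsP=> k /andP[/eqP ku /eqP kv] hu k' k'v.
apply: connect_trans (hu _ ku) _; rewrite -[edg k]edg_opp.
by apply: around; rewrite k'v kv.
Qed.

Lemma delta_eq0 eps : delta eps = 0 -> forall e e', eps e = eps e'.
Proof.
move=> d0 e e'.
apply: (connect_propagate (P := fun x => eps e = eps x) _ (medial_connected e e')) => //.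
move=> u v /existsP[a /andP[/eqP<- /eqP<-]] ->.
by move/ffunP/(_ a): d0; rewrite !ffunE => /eqP; rewrite subr_eq0 => /eqP.
Qed.

(** The arrows of the path, added with multiplicity, form the required chain. *)
Lemma nonpos_chain g e e' :
  connect [rel x y | [exists a, [&& src a == x, tgt a == y & g a <= 0]]] e e' ->
  exists c, [/\ forall a, 0 <= c a, boundary c = chi e' - chi e
              & \sum_a c a * g a <= 0].
Proof.
set r := (X in connect X); move=> ee'.
apply: (connect_propagate (P := fun x => exists c, [/\ forall a, 0 <= c a,
  boundary c = chi x - chi e & \sum_a c a * g a <= 0]) _ ee').
  move=> u v /existsP[a /and3P[/eqP<- /eqP<- ga]] [c [c0 cb cg]].
  exists (c + arrow a); split.
  - by move=> b; rewrite !ffunE addr_ge0.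
  - by rewrite boundaryD boundary_arrow cb addrC addrA subrK.
  - under eq_bigr do rewrite ffunE mulrDl.
    by rewrite big_split /= sum_arrow; lra.
exists 0; split=> [a||]; first by rewrite ffunE.
  rewrite subrr; apply/ffunP=> x; rewrite !ffunE.
  by rewrite !big1 ?subrr // => a _; rewrite ffunE.
by rewrite big1 // => a _; rewrite ffunE mul0r.
Qed.

Lemma cohom_class_delta g eps : cohom_class (g + delta eps) = cohom_class g.
Proof.
apply/eqP; rewrite -Quotient.idealrBE addrC addKr.
by apply/asboolP; exists eps.
Qed.

End MedialGraph.

(** * Compatible functions and invisible cycles *)

Section Decorated.

Variables (G : planarGraph) (omega : weight G).
Implicit Types (a b : angle G) (e : edge G) (c : C1 G) (g h : L omega).
Implicit Types (eps : C0 G).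

Lemma L_ge0 g a : 0 <= val g a.
Proof. by case: g => g /= /andP[/forallP]. Qed.

Lemma L_cohom g : cohom_class (val g) = omega.
Proof. by case: g => g /= /andP[_ /eqP]. Qed.

Lemma L_shift g eps : (forall a, 0 <= (val g + delta eps) a) ->
  exists h, val h = val g + delta eps.
Proof.
move=> ge0; suff cpt : compatible omega (val g + delta eps).
  by exists (exist (fun w => compatible omega w) _ cpt).
by apply/andP; split; [apply/forallP | rewrite cohom_class_delta L_cohom].
Qed.

(* A potential of least total violation violates no constraint: raising it by 1
   on the set reachable from the target of a violating arrow along non-positive
   arrows lowers the violation, unless that set contains the source of the arrow,
   which would close up a cycle of negative weight. *)
Lemma L_inhabited :
  (forall c, angular_cycle c -> c <> 0 -> 0 <= lambda omega c) ->
  exists g : L omega, True.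
Proof.
move=> cycle_ge0; pose w := repr omega.
have wE : cohom_class w = omega by rewrite /cohom_class reprK.
pose viol eps := (\sum_a absz (Num.min 0%R ((w + delta eps)%R a)))%N.
have [eps epsmin] := exists_minimizer viol 0.
set g := w + delta eps.
have gE : cohom_class g = omega by rewrite cohom_class_delta.
suff g0 : compatible omega g by exists (exist (fun w => compatible omega w) _ g0).
apply/andP; split; last by rewrite gE.
apply/forallP => a0; rewrite leNgt; apply/negP=> ga0.
pose r := [rel x y | [exists a, [&& src a == x, tgt a == y & g a <= 0]]].
pose S e := connect r (tgt a0) e.
case: (boolP (S (src a0))) => [/nonpos_chain[c [c0 cb cg]] | notS].
  have cyc0 : boundary (c + arrow a0) = 0.
    by rewrite boundaryD boundary_arrow cb addrA subrK subrr.
  have := cycle_ge0 (c + arrow a0).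
  rewrite (lambdaE cyc0 gE); under eq_bigr do rewrite ffunE mulrDl.
  rewrite big_split /= sum_arrow => nonneg.
  suff : 0 <= \sum_a c a * g a + g a0 by lra.
  apply: nonneg; first by split=> // a; rewrite !ffunE addr_ge0.
  (* The coefficient of [c + arrow a0] at [a0] is at least 1, so this cycle is non-zero. *)
  move/ffunP/(_ a0); rewrite !ffunE eqxx /= => c1; have := c0 a0; move: c1; lia.
pose eps' := eps + [ffun e => (S e)%:R].
have := epsmin eps'; rewrite leqNgt => /negP; apply.
have g'E a : (w + delta eps') a = g a + (S (tgt a))%:R - (S (src a))%:R.
  by rewrite deltaD addrA -/g [LHS]ffunE [in LHS]ffunE !ffunE addrA.
rewrite /viol (bigD1 a0) //= [X in (_ < X)%N](bigD1 a0) //= -addSn leq_add //.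
  (* The arrow [a0] enters [S] from outside, so its negative value rises by 1. *)
  rewrite g'E (negPf notS) /S connect0 -/g subr0 /=.
  have lt_viol (u : int) : u < 0 ->
      (absz (Num.min 0%R (u + 1)%R) < absz (Num.min 0%R u))%N by lia.
  exact: lt_viol ga0.
apply: leq_sum => a _; rewrite g'E -/g.
(* An arrow loses value only if it leaves [S]; it is then positive, since otherwise its target would
   be reachable, and losing 1 creates no violation. *)
suff : (g a <= g a + (S (tgt a))%:R - (S (src a))%:R) || (0 < g a).
  have le_viol (u v : int) : (u <= v) || (0 < u) && (u - 1 <= v) ->
      (absz (Num.min 0%R v) <= absz (Num.min 0%R u))%N by lia.
  case/orP=> le_g; apply: le_viol; rewrite ?le_g //=.
  by rewrite -addrA lerD2l; case: (S _); case: (S _); rewrite ?orbT.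
case: (boolP (S (src a))) => [Ss|_]; last by rewrite subr0 lerDl ler0n.
case: (boolP (S (tgt a))) => [_|St]; first by rewrite addrK lexx.
apply/orP; right.
rewrite ltNge; apply: contra St => ga.
by apply: connect_trans Ss (connect1 _); apply/existsP; exists a; rewrite !eqxx.
Qed.

(** The value of the cycle, computed with [g], is a sum of non-negative terms that equals zero. *)
Lemma invisible_eq0 g c a : invisible_cycle omega c -> c a != 0 -> val g a = 0.
Proof.
case=> [[c0 c_ge0] _]; rewrite (lambdaE c0 (L_cohom g)) => /eqP.
rewrite psumr_eq0 => [/allP/(_ a)|b _]; last by rewrite mulr_ge0 ?L_ge0.
rewrite mem_index_enum mulf_eq0 => /(_ isT) /= /orP[/eqP->|/eqP->] //.
Qed.

(** A cycle is balanced at [tgt a], so the positive inflow there forces an outflow. *)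
Lemma cycle_out c a : angular_cycle c -> c a != 0 ->
  exists2 b, src b = tgt a & c b != 0.
Proof.
case=> c0 c_ge0 ca; case: (pickP (fun b => (src b == tgt a) && (c b != 0))).
  by move=> b /andP[/eqP]; exists b.
move=> out0; have : boundary c (tgt a) = 0 by rewrite c0 ffunE.
rewrite ffunE [X in _ - X]big1 => [|b sb]; last first.
  by have := out0 b; rewrite sb /=; case: eqP.
rewrite subr0 => /eqP; rewrite psumr_eq0 // => /allP/(_ a).
by rewrite mem_index_enum eqxx (negPf ca) => /(_ isT).
Qed.

(* Following zero arrows within S eventually runs into a closed walk. *)
Lemma connected_invisible_in g (S : {pred edge G}) e0 : e0 \in S ->
  (forall e, e \in S -> exists a, [/\ src a = e, tgt a \in S & val g a = 0]) ->
  exists c a, [/\ connected_invisible omega c, c a != 0 & src a \in S].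
Proof.
move=> S0 out.
have /choice[nxt nxtP] e : exists a, e \in S ->
    [/\ src a = e, tgt a \in S & val g a = 0].
  have [/out[a Pa]|_] := boolP (e \in S); first by exists a.
  (* Outside [S] any angle serves as a default value. *)
  by have [a _] := out _ S0; exists a.
pose f e := tgt (nxt e).
have fS e n : e \in S -> iter n f e \in S.
  by move=> Se; elim: n => //= n /nxtP[].
have [x [p [Sx xp]]] : exists x p, x \in S /\ iter p.+1 f x = x.
  (* The orbit of [e0] first returns to some [iter i f e0]; the period [order f e0 - i] is positive
     and is written [p.+1]. *)
  have := looping_order f e0; rewrite /looping => /trajectP[i ip eq_i].
  exists (iter i f e0), (order f e0 - i).-1; split; first exact: fS.
  by rewrite -iterD prednK ?subn_gt0 // subnK // ltnW.
pose c : C1 G := \sum_(i < p.+1) arrow (nxt (iter i f x)).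
have cE a : c a = \sum_(i < p.+1) (a == nxt (iter i f x))%:R.
  by rewrite /c sum_ffunE; apply: eq_bigr => i _; rewrite ffunE.
have c_nxt i : (i < p.+1)%N -> c (nxt (iter i f x)) != 0.
  move=> ip; rewrite cE (bigD1 (Ordinal ip)) //= eqxx.
  by rewrite gt_eqF // ltr_pwDl // sumr_ge0 // => j _; rewrite ler0n.
have c_supp a : c a != 0 -> exists2 i, (i < p.+1)%N & a = nxt (iter i f x).
  rewrite cE; apply: contra_neqP => no; rewrite big1 // => i _.
  by case: eqP => // ai; case: no; exists i.
have src_nxt i : src (nxt (iter i f x)) = iter i f x by have [] := nxtP _ (fS x i Sx).
have c0 : boundary c = 0.
  (* The boundaries telescope. The induction runs over all lengths, and the walk closes up at length
     [p.+1]. *)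
  rewrite /c; have -> n : boundary (\sum_(i < n) arrow (nxt (iter i f x))) =
      chi (iter n f x) - chi x; last by rewrite xp subrr.
  elim: n => [|n IH].
    rewrite big_ord0 subrr; apply/ffunP=> e; rewrite !ffunE.
    by rewrite !big1 ?subrr // => a _; rewrite ffunE.
  by rewrite big_ord_recr boundaryD IH boundary_arrow /= src_nxt addrC addrA subrK.
exists c, (nxt x); split; [split; first split | exact: (c_nxt 0%N) | by have [->] := nxtP _ Sx].
- by split=> // a; rewrite cE sumr_ge0 // => j _; rewrite ler0n.
- by move=> c_eq0; have := c_nxt 0%N isT; rewrite c_eq0 ffunE eqxx.
- rewrite (lambdaE c0 (L_cohom g)) big1 // => a _.
  have [->|/c_supp[i _ ->]] := eqVneq (c a) 0; first by rewrite mul0r.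
  by have [_ _ ->] := nxtP _ (fS x i Sx); rewrite mulr0.
have sym : symmetric (support_adj c).
  by move=> e e'; apply: eq_existsb => a; rewrite orbC.
have from_x i : (i <= p.+1)%N -> connect (support_adj c) x (iter i f x).
  elim: i => [|i IH] ip; first exact: connect0.
  apply: connect_trans (IH (ltnW ip)) (connect1 _); apply/existsP.
  by exists (nxt (iter i f x)); rewrite c_nxt // src_nxt !eqxx.
have supp_x e : e \in support_vertices c -> connect (support_adj c) x e.
  rewrite inE => /existsP[a /andP[/c_supp[i ip ->]]].
  case/orP=> /eqP <-; first by rewrite src_nxt from_x // ltnW.
  exact: (from_x i.+1).
move=> e e' /supp_x xe /supp_x; apply: connect_trans.
by rewrite (sym_connect_sym sym).
Qed.

(** The invisible cycle given by the hypothesis may have disconnected support. Its arrows are zero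
    arrows, and each is followed by another one, so [connected_invisible_in] applies to the set of
    their sources. *)
Lemma exists_connected_invisible : nilpotency_degree_zero omega ->
  exists c a, connected_invisible omega c /\ c a != 0.
Proof.
case=> [[c [cyc c_neq0 lam0]]] /L_inhabited[g _].
have [a ca] : exists a, c a != 0.
  apply/not_existsP => no; apply: c_neq0; apply/ffunP=> a; rewrite ffunE.
  by apply/eqP/negPn/negP/no.
pose S := [pred e | [exists b, (src b == e) && (c b != 0)]].
have inS b : c b != 0 -> src b \in S by move=> cb; apply/existsP; exists b; rewrite eqxx.
have [||c' [b []]] := @connected_invisible_in g S (src a); [exact: inS | | by exists c', b].
move=> e /existsP[b /andP[/eqP be cb]]; exists b; split=> //.
  by have [b' <- cb'] := cycle_out cyc cb; exact: inS.
by apply: (@invisible_eq0 _ c).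
Qed.

Lemma src_support c a : c a != 0 -> src a \in support_vertices c.
Proof. by move=> ca; rewrite inE; apply/existsP; exists a; rewrite ca eqxx. Qed.

(** Both [g] and [h] vanish on the arrows of [c], so [eps] agrees at the two ends of each. *)
Lemma support_potential_const g h eps c : val h = val g + delta eps ->
  connected_invisible omega c -> {in support_vertices c &, forall e e', eps e = eps e'}.
Proof.
move=> hE [inv conn] e e' ce ce'; have := conn e e' ce ce'.
move/(connect_propagate (P := fun x => eps e = eps x)); apply=> // u v.
case/existsP=> a /andP[ca uv] ->; have := invisible_eq0 h inv ca.
rewrite hE !ffunE (invisible_eq0 g inv ca) add0r => /eqP; rewrite subr_eq0.
by case/orP: uv => /andP[/eqP-> /eqP->] /eqP.
Qed.

(** Adjacent cycles share a vertex, where their constant values of [eps] agree; induction along a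
    path of cycles does the rest. *)
Lemma invisible_potential_const g h eps c c' e e' :
  Ginv_connected omega -> val h = val g + delta eps ->
  connected_invisible omega c -> e \in support_vertices c ->
  connected_invisible omega c' -> e' \in support_vertices c' -> eps e = eps e'.
Proof.
move=> conn hE ci ce ci' ce'.
pose vc : Ginv omega := exist _ c (asboolT ci).
pose vc' : Ginv omega := exist _ c' (asboolT ci').
have invE (u : Ginv omega) : connected_invisible omega (val u) by case: u => u /= /asboolP.
have := conn vc vc'; rewrite -[c]/(val vc) in ce; rewrite -[c']/(val vc') in ce'.
move=> path; elim: path e e' ce ce' => {c c' ci ci' vc vc'} //.
- move=> u v [k [uk vk]] e e' eu ev.
  rewrite (support_potential_const hE (invE u) eu uk).
  exact: (support_potential_const hE (invE v)).
- by move=> u e e' eu eu'; apply: (support_potential_const hE (invE u)).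
- by move=> u v _ IH e e' eu ev; rewrite (IH e' e).
- move=> u v z _ IH1 _ IH2 e e' eu ez.
  (* The intermediate cycle is non-zero, so it has a vertex at which to compare. *)
  have [k kv] : exists k, k \in support_vertices (val v).
    have [[_ v_neq0 _] _] := invE v.
    have [a va] : exists a, val v a != 0.
      apply/not_existsP => no; apply: v_neq0; apply/ffunP=> a; rewrite ffunE.
      by apply/eqP/negPn/negP/no.
    by exists (src a); exact: src_support.
  by rewrite (IH1 e k) // (IH2 k e').
Qed.

(** * Potentials normalised at a fixed edge *)

Section Potential.

Variable e0 : edge G.

Lemma exists_potential g h : exists eps, val h = val g + delta eps /\ eps e0 = 0.
Proof.
have [[eg gE] [eh hE]] := (cohom_classE (L_cohom g), cohom_classE (L_cohom h)).
exists ([ffun e => (eh e - eg e) - (eh e0 - eg e0)]); split; last by rewrite ffunE subrr.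
by rewrite gE hE; apply/ffunP=> a; rewrite !ffunE; ring.
Qed.

Definition potential g h : C0 G := projT1 (cid (exists_potential g h)).

Lemma potentialE g h : val h = val g + delta (potential g h).
Proof. by rewrite /potential; case: cid => eps []. Qed.

Lemma potential_root g h : potential g h e0 = 0.
Proof. by rewrite /potential; case: cid => eps []. Qed.

(** Two such primitives differ by a function with zero coboundary, which is constant by connectivity
    and vanishes at [e0]. *)
Lemma potential_unique g h eps :
  val h = val g + delta eps -> eps e0 = 0 -> potential g h = eps.
Proof.
move=> hE eps0; apply/ffunP => e.
have : delta (potential g h - eps) = 0.
  by apply: (addrI (val g + delta eps)); rewrite addr0 -addrA -deltaD subrKC -potentialE.
move/delta_eq0/(_ e e0); rewrite [LHS]ffunE [RHS]ffunE [X in _ + X]ffunE.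
rewrite [X in _ = _ + X]ffunE potential_root eps0 subr0 => /eqP.
by rewrite subr_eq0 => /eqP.
Qed.

Lemma potentialD g h k : potential g k = potential g h + potential h k.
Proof.
apply: potential_unique; last by rewrite ffunE !potential_root addr0.
by rewrite deltaD addrA -!potentialE.
Qed.

Lemma potentialxx g : potential g g = 0.
Proof. by apply: (addrI (potential g g)); rewrite -potentialD addr0. Qed.

Lemma potential_inj g : injective (potential g).
Proof. by move=> x y xy; apply/val_inj; rewrite (potentialE g) xy -potentialE. Qed.

Lemma potential_shift g eps : (forall a, 0 <= (val g + delta eps) a) -> eps e0 = 0 ->
  exists h, potential g h = eps.
Proof.
by move=> /L_shift[h hE] eps0; exists h; apply: potential_unique.
Qed.

Lemma potential_le g h a :
  0 <= val g a + potential g h (tgt a) - potential g h (src a).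
Proof. by have := L_ge0 h a; rewrite (potentialE g) !ffunE addrA. Qed.

(** The constraint at an arrow [a] says that the potential drops by at most [g a] from source to
    target, and a pointwise minimum inherits such bounds. *)
Lemma exists_meet g x y : exists z : L omega,
  forall e, potential g z e = Num.min (potential g x e) (potential g y e).
Proof.
pose eps : C0 G := [ffun e => Num.min (potential g x e) (potential g y e)].
have [||z zE] := @potential_shift g eps.
- move=> a; rewrite !ffunE addrA; move: (potential_le g x a) (potential_le g y a).
  move: (val g a) (potential g x _) (potential g y _) (potential g x _) (potential g y _).
  by move=> u1 u2 u3 u4 u5; lia.
- by rewrite ffunE !potential_root minxx.
- by exists z => e; rewrite zE ffunE.
Qed.

Lemma exists_join g x y : exists z : L omega,
  forall e, potential g z e = Num.max (potential g x e) (potential g y e).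
Proof.
pose eps : C0 G := [ffun e => Num.max (potential g x e) (potential g y e)].
have [||z zE] := @potential_shift g eps.
- move=> a; rewrite !ffunE addrA; move: (potential_le g x a) (potential_le g y a).
  move: (val g a) (potential g x _) (potential g y _) (potential g x _) (potential g y _).
  by move=> u1 u2 u3 u4 u5; lia.
- by rewrite ffunE !potential_root maxxx.
- by exists z => e; rewrite zE ffunE.
Qed.

(** On a directed path from [e0], where the potential is 0, each arrow [a] lowers it by at most
    [g a]. *)
Lemma potential_bounded_below g e : exists l : int, forall h, l <= potential g h e.
Proof.
apply: (connect_propagate (P := fun e => exists l : int, forall h, l <= potential g h e) _
  (medial_connected e0 e)); last by exists 0 => h; rewrite potential_root.
move=> u v /existsP[a /andP[/eqP<- /eqP<-]] [l lP]; exists (l - val g a) => h.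
have := potential_le g h a; have := lP h.
by move: (potential g h _) (potential g h _) (val g a) => u1 u2 u3; lia.
Qed.

(** A function of least total potential works: if it exceeded [h] somewhere, its meet with [h] would
    have a smaller total. *)
Lemma exists_min_potential g : exists m, forall h e, potential g m e <= potential g h e.
Proof.
have /choice[l lP] := potential_bounded_below g.
(* Subtracting the lower bound [l] makes every term non-negative, so [absz] loses nothing. *)
pose f h := (\sum_e absz (potential g h e - l e)%R)%N.
have [m mP] := exists_minimizer f g; exists m => h e; rewrite leNgt; apply/negP => lt_hm.
have [z zE] := exists_meet g m h.
have := mP z; rewrite leqNgt => /negP; apply.
rewrite /f (bigD1 e) //= [X in (_ < X)%N](bigD1 e) //= -addSn leq_add //.
  by rewrite zE; move: lt_hm (lP e h) (lP e m);
     move: (l e) (potential _ _ _) (potential _ _ _) => u1 u2 u3; lia.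
apply: leq_sum => k _; rewrite zE; move: (lP k h) (lP k m).
by move: (l k) (potential _ _ _) (potential _ _ _) => u1 u2 u3; lia.
Qed.

(** * The reachability order as the pointwise order of potentials *)

Section Order.

Hypothesis conn : Ginv_connected omega.
Variables (c0 : C1 G) (a0 : angle G).
Hypotheses (c0_inv : connected_invisible omega c0) (c0a0 : c0 a0 != 0).
Hypothesis e0E : e0 = src a0.

Lemma potential_invisible g h c e : connected_invisible omega c ->
  e \in support_vertices c -> potential g h e = 0.
Proof.
move=> ci ce; rewrite -(potential_root g h) e0E.
exact: (invisible_potential_const conn (potentialE g h) ci ce c0_inv (src_support c0a0)).
Qed.

(** The arrow [a0] has value 0 and distinct ends, so a move at its source [e0] would make it
    negative. *)
Lemma movable_neq_root g e : movable g e -> e0 != e.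
Proof.
move=> mov; apply/eqP => e0e; have := mov a0; rewrite !ffunE.
rewrite (invisible_eq0 g (proj1 c0_inv) c0a0) -e0e e0E eqxx.
by rewrite eq_sym (negPf (src_neq_tgt a0)).
Qed.

(** A move at [e] lowers only arrows with source [e], and by at most 1, so a blocking arrow has
    value 0. *)
Lemma not_movable g e : ~ movable g e -> exists2 a, src a = e & val g a = 0.
Proof.
move/existsNP=> [a /negP]; rewrite -ltNge !ffunE => neg.
have := L_ge0 g a; move: neg; case: (eqVneq (src a) e) => [se|_] neg ga.
  exists a => //; move: neg ga; case: (tgt a == e) => /=; move: (val g a) => u; lia.
by move: neg ga; case: (tgt a == e) => /=; move: (val g a) => u; lia.
Qed.

Lemma potential_step g h e : movable g e -> val h = val g + delta (chi e) ->
  potential g h = chi e.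
Proof.
move=> mov hE; apply: potential_unique => //.
by rewrite ffunE (negPf (movable_neq_root mov)).
Qed.

(* If every edge of the support of the potential is blocked by a zero arrow, these
   arrows stay in the support, which then meets an invisible cycle, where the
   potential vanishes. *)
Lemma exists_movable x y : (forall e, 0 <= potential x y e) -> x <> y ->
  exists2 e, movable x e & 0 < potential x y e.
Proof.
move=> ge0 xy; apply: contrapT => no.
pose S := [pred e | 0 < potential x y e].
have [e eS] : exists e, e \in S.
  apply/not_existsP => empty; apply/xy/(@potential_inj x); rewrite potentialxx.
  apply/ffunP => e; rewrite ffunE; apply/eqP; rewrite eq_sym eq_le ge0 /= leNgt andbT.
  exact/negP/empty.
have [//||c [a [ci ca]]] := @connected_invisible_in x S e.
  move=> k kS; have [|a ak xa] := @not_movable x k; first by move=> mk; apply: no; exists k.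
  exists a; split=> //; have := potential_le x y a; rewrite xa ak !inE in kS *.
  by rewrite add0r subr_ge0; apply: lt_le_trans.
by rewrite inE (potential_invisible _ _ ci (src_support ca)) ltxx.
Qed.

(** Each move adds some [chi e] to the potential. Conversely, a move at an edge of positive
    potential lowers the remaining total by 1, which gives an induction. *)
Lemma L_leP x y : L_le x y <-> forall e, 0 <= potential x y e.
Proof.
split=> [|ge0].
  elim=> {x y} [x y [e mov yE] k|x k|x y z _ IH1 _ IH2 k].
  - by rewrite (potential_step mov yE) ffunE ler0n.
  - by rewrite potentialxx ffunE.
  - by rewrite (potentialD x y z) ffunE addr_ge0.
have [n] := ubnP (\sum_e absz (potential x y e))%N; elim: n x ge0 => // n IH x ge0 lt_n.
have [<-|xy] := pselect (x = y); first exact: rt_refl.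
have [e mov pos] := exists_movable ge0 xy.
have [z zE] := L_shift mov.
have zyE k : potential z y k = potential x y k - (k == e)%:R.
  by rewrite (potentialD x z y) (potential_step mov zE) !ffunE addrC addKr.
apply: (rt_trans _ _ _ z); first by apply: rt_step; exists e.
apply: IH => [k|].
  rewrite zyE; case: (eqVneq k e) => [->|_]; last by rewrite subr0.
  by rewrite subr_ge0 -gtz0_ge1.
rewrite ltnS in lt_n; apply: leq_trans lt_n.
rewrite (bigD1 e) //= [X in (_ < X)%N](bigD1 e) //= -addSn leq_add //.
  by rewrite zyE eqxx; move: pos; move: (potential x y e) => u; lia.
apply: leq_sum => k /negPf ke; by rewrite zyE ke subr0.
Qed.

Lemma L_le_potential g x y :
  L_le x y <-> forall e, potential g x e <= potential g y e.
Proof.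
by rewrite L_leP; split=> le e; move: (le e); rewrite (potentialD g x y) ffunE lerDl.
Qed.

Lemma exists_minimum g : exists m, forall h, L_le m h.
Proof.
have [m mP] := exists_min_potential g; exists m => h.
by apply/(L_le_potential g) => e; apply: mP.
Qed.

(** * BMS states over the minimum *)

Section BMS.

Variable m : L omega.
Hypothesis m_min : forall h, L_le m h.

(** The edge [e0] lies on [c0], so the BMS condition forces [d e0 = 0], which is the normalisation
    of the potential. *)
Lemma dimvE (s : BMSplus m) : Defs.dimv (val s) = potential m (forget s).
Proof.
case: s => [[[[fp fm] d] st] /= fmE]; rewrite /forget /fplus /Defs.dimv /=.
move/asboolP: (st) => [[_ fpE] d0]; rewrite -(eqP fmE) /fminus /=.
apply/esym/potential_unique => //; rewrite e0E.
by apply: (d0 _ c0) => //; apply: src_support.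
Qed.

Lemma fminusE (s : BMSplus m) : fminus (val s) = m.
Proof. exact/eqP/(valP s). Qed.

Lemma forget_inj : injective (@forget G omega m).
Proof.
move=> s t st; apply/val_inj/val_inj.
have := dimvE s; rewrite st -dimvE; move: st (fminusE s) (fminusE t).
rewrite /forget /fplus /fminus /Defs.dimv.
by case: (val (val s)) (val (val t)) => [[? ?] ?] [[? ?] ?] /= -> -> -> ->.
Qed.

(** The potential from [m] serves as dimension vector: minimality of [m] makes it non-negative, and
    it vanishes on the connected invisible cycles. *)
Lemma forget_surj h : exists s : BMSplus m, forget s = h.
Proof.
have st : `[< is_BMS (h, m, potential m h) >].
  apply/asboolP; split; first by split; [exact/L_leP | exact: potentialE].
  by move=> e c ci; apply: potential_invisible ci.
pose s : BMS omega := exist (fun x => `[< is_BMS x >]) _ st.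
have sm : fminus s == m by [].
by exists (exist (fun x => fminus x == m) s sm).
Qed.

(** Paths lift step by step, since the dimension vectors of the lifted states are potentials and a
    move at [e] adds [chi e] to both. *)
Lemma BMSplus_leP (s t : BMSplus m) : BMSplus_le s t <-> L_le (forget s) (forget t).
Proof.
split=> [|le_st].
  elim=> {s t} [s t [e [mov tE _ _]]|s|s t u _ le1 _ le2].
  - by apply: rt_step; exists e.
  - exact: rt_refl.
  - exact: rt_trans le1 le2.
have /choice[lift liftK] := forget_surj.
have liftf u : lift (forget u) = u by apply: forget_inj.
rewrite -[s]liftf -[t]liftf; elim: le_st => {s t} [x y [e mov yE]|x|x y z _ le1 _ le2].
- apply: rt_step; exists e; rewrite !fminusE !dimvE !liftK; split=> //.
  + by rewrite -[fplus _]/(forget _) liftK.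
  + by rewrite -2![fplus _]/(forget _) !liftK.
  + by rewrite (potentialD m x y) (potential_step mov yE).
- exact: rt_refl.
- exact: rt_trans le1 le2.
Qed.

End BMS.
End Order.
End Potential.
End Decorated.

Theorem corollary3p24 (G : planarGraph) (omega : weight G) :
  nilpotency_degree_zero omega ->
  Ginv_connected omega ->
  exists (DL : distrLatticeOn (@L_le G omega)) (fmin : L omega),
    (forall g : L omega, L_le fmin g) /\
    exists DB : distrLatticeOn (@BMSplus_le G omega fmin),
      distr_lattice_iso DB DL (@forget G omega fmin).
Proof.
move=> nilp conn; have [c0 [a0 [c0_inv c0a0]]] := exists_connected_invisible nilp.
have [g _] := L_inhabited (proj2 nilp).
(* The argument [erefl] fixes the normalising edge as [src a0]. *)
have [m m_min] := exists_minimum conn c0_inv c0a0 erefl g.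
have /choice[meet meetE] (p : L omega * L omega) := exists_meet (src a0) m p.1 p.2.
have /choice[join joinE] (p : L omega * L omega) := exists_join (src a0) m p.1 p.2.
have /choice[lift liftK] := forget_surj conn c0_inv c0a0 erefl m_min.
have inj := forget_inj c0_inv c0a0 erefl (m := m).
have leP := L_le_potential conn c0_inv c0a0 erefl m.
have [DL [DLmeet DLjoin]] := distrLatticeOn_pointwise (@potential_inj _ _ (src a0) m) leP
  (fun x y => meetE (x, y)) (fun x y => joinE (x, y)).
exists DL, m; split=> //.
(* The operations on BMS states are pulled back along the bijection [forget], which is then a
   morphism by construction. *)
pose phi (s : BMSplus m) := potential (src a0) m (forget s).
have [|s t|s t e|s t e|DB [DBmeet DBjoin]] :=
  @distrLatticeOn_pointwise _ _ (@BMSplus_le G omega m) phi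
  (fun s t => lift (meet (forget s, forget t))) (fun s t => lift (join (forget s, forget t))).
- exact/inj_comp/inj/potential_inj.
- by rewrite -leP; exact: (BMSplus_leP conn c0_inv c0a0 erefl m_min).
- by rewrite /phi liftK meetE.
- by rewrite /phi liftK joinE.
exists DB; rewrite /distr_lattice_iso DLmeet DLjoin DBmeet DBjoin; split.
- by exists lift => // s; apply: inj.
- by move=> s t; rewrite /= liftK.
- by move=> s t; rewrite /= liftK.
Qed.
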